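(* (a) Let $\mathbf p=(p_n)\subset[1,\infty)$ be an unbounded sequence. Then the modular topology $\tau_{\rho_{\mathbf p}}$ on $\ell^{(p_n)}$ is not first-countable. (b) Let $\Omega\subset\mathbb{R}^n$ be a domain and let $p\in C(\Omega)$ satisfy $1\le p(x)<\infty$ for every $x\in\Omega$, with $p^+=\sup_\Omega p=\infty$. Then the modular topology $\tau_{\rho_p}$ on $L^{p(\cdot)}(\Omega)$ is not first-countable.
   Context: Sequence space: for $\mathbf p=(p_n)\subset[1,\infty)$ and a real sequence $(a_j)$, $\rho_{\mathbf p}((a_j))=\sum_{j=1}^\infty|a_j|^{p_j}\in[0,\infty]$, and $\ell^{(p_n)}=\{(a_j)\in\mathbb{R}^{\mathbb N}:\rho_{\mathbf p}(\lambda(a_j))<\infty\text{ for some }\lambda>0\}$. Lebesgue space: for measurable $u$ on $\Omega$ (functions equal a.e. being identified), $\rho_p(u)=\int_\Omega|u(x)|^{p(x)}\,dx$, and $L^{p(\cdot)}(\Omega)=\{u:\rho_p(\lambda u)<\infty\text{ for some }\lambda>0\}$. A domain is a nonempty connected open set. Modular topology: for either space, denoted $E$ with modular $\rho$, $B_{\rho,\varepsilon}(x)=\{y\in E:\rho(y-x)<\varepsilon\}$, and $A\subseteq E$ is $\tau_\rho$-open iff for every $x\in A$ there exists $\varepsilon>0$ with $B_{\rho,\varepsilon}(x)\subset A$. (The balls are not asserted to be open.) *)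

(* Defs.v *)
From HB Require Import structures.
From mathcomp Require Import all_boot all_order all_algebra.
From mathcomp Require Import generic_quotient ring_quotient.
From mathcomp Require Import all_classical all_reals all_analysis.

Set Implicit Arguments.
Unset Strict Implicit.
Unset Printing Implicit Defensive.

Import Order.TTheory GRing.Theory Num.Theory.
Import numFieldNormedType.Exports.

Local Open Scope classical_set_scope.
Local Open Scope ring_scope.

Definition first_countable (T : topologicalType) : Prop :=
  forall x : T, exists B : set (set T),
    [/\ countable B, B `<=` nbhs x &
        forall U, nbhs x U -> exists2 V, B V & V `<=` U].

Definition is_domain (T : topologicalType) (O : set T) : Prop :=
  [/\ O !=set0, open O & connected O].

Section modular_space.
Context {R : realType} {V : lmodType R} (rho : V -> \bar R).

Definition modular_carrier : set V :=
  [set x | exists2 l : R, 0 < l & (rho (l *: x) < +oo)%E].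

Definition modular_space : Type := set_type modular_carrier.

HB.instance Definition _ := Choice.on modular_space.

(* The difference is taken in [V], where [rho] is defined everywhere. *)
Definition modular_ball (x : modular_space) (e : R) : set modular_space :=
  [set y | (rho (val y - val x)%R < e%:E)%E].

Definition modular_open (A : set modular_space) : Prop :=
  forall x, A x -> exists2 e : R, 0 < e & modular_ball x e `<=` A.

Let modular_openT : modular_open setT.
Proof. by move=> x _; exists 1. Qed.

Let modular_openI : setI_closed modular_open.
Proof.
move=> A B oA oB x [Ax Bx].
have [e e0 eA] := oA x Ax; have [f f0 fB] := oB x Bx.
exists (Num.min e f); first by rewrite lt_min e0 f0.
move=> y /= yef; split; [apply: eA|apply: fB];
  by apply: (lt_le_trans yef); rewrite lee_fin ge_min lexx ?orbT.
Qed.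

Let modular_open_bigcup (I : Type) (F : I -> set modular_space) :
  (forall i, modular_open (F i)) -> modular_open (\bigcup_i F i).
Proof.
move=> oF x [i _ Fix]; have [e e0 eF] := oF i x Fix.
by exists e => // y /eF Fiy; exists i.
Qed.

HB.instance Definition _ := isOpenTopological.Build modular_space
  modular_openT modular_openI modular_open_bigcup.

Lemma open_modularE : @open modular_space = modular_open.
Proof. by []. Qed.

End modular_space.

(* [R^o] is [R] as a module over itself, so that sequences form an lmodType. *)
Definition seq_modular {R : realType} (p : nat -> R) (a : nat -> R^o) : \bar R :=
  (\sum_(0 <= j <oo) (`|a j| `^ p j)%:E)%E.

Section lebesgue_tuple.
Context {R : realType}.
Local Notation mR := (measurableTypeR R).

Definition tcons n (x : mR * n.-tuple mR) : n.+1.-tuple mR :=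
  [tuple of x.1 :: x.2].

Lemma measurable_tcons n : measurable_fun setT (@tcons n).
Proof. exact: measurable_cons. Qed.

Section cons_measure.
Variables (n : nat) (mu : {sigma_finite_measure set (n.-tuple mR) -> \bar R}).

Definition cons_measure : set (n.+1.-tuple mR) -> \bar R :=
  pushforward (@lebesgue_measure R \x mu)%E (@tcons n).

(* The library's measure structure on [pushforward] takes a measurability proof. *)
HB.instance Definition _ := Measure.copy cons_measure
  (measure_function_pushforward__canonical__measure_function_Measure
    (@lebesgue_measure R \x mu)%E (@measurable_tcons n)).

Let cons_measure_sigma_finite : sigma_finite setT cons_measure.
Proof.
have /sigma_finiteP[F [TF ndF Foo]] := sigma_finiteT (@lebesgue_measure R).
have /sigma_finiteP[G [TG ndG Goo]] := sigma_finiteT mu.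
pose g (t : n.+1.-tuple mR) : mR * n.-tuple mR := (thead t, [tuple of behead t]).
have gK : cancel (@tcons n) g.
  by move=> [x t]; rewrite /g /tcons /=; congr pair; exact: val_inj.
have mg : measurable_fun setT g.
  apply/measurable_fun_pair; first exact: measurable_tnth.
  exact: measurable_behead.
exists (fun k => g @^-1` (F k `*` G k)).
  rewrite -preimage_bigcup; apply/seteqP; split=> // t _.
  have : setT (g t).1 by [].
  rewrite TF => -[k _ Fk].
  have : setT (g t).2 by [].
  rewrite TG => -[l _ Gl].
  exists (maxn k l) => //; split.
    by move: Fk; exact/subsetPset/ndF/leq_maxl.
  by move: Gl; exact/subsetPset/ndG/leq_maxr.
move=> k; have [mF Fk] := Foo k; have [mG Gk] := Goo k; split.
  by rewrite -[X in measurable X]setTI; apply: mg => //; exact: measurableX.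
rewrite /cons_measure /pushforward (_ : _ @^-1` _ = F k `*` G k).
  by rewrite product_measure1E// lte_mul_pinfty// ge0_fin_numE.
rewrite -comp_preimage (_ : g \o _ = id)//; apply/funext => x; exact: gK.
Qed.

HB.instance Definition _ := @Measure_isSigmaFinite.Build _ _ _ cons_measure
  cons_measure_sigma_finite.

End cons_measure.

Fixpoint lebesgue_tuple n : {sigma_finite_measure set (n.-tuple mR) -> \bar R} :=
  match n with
  | 0 => dirac ([tuple] : 0.-tuple mR)
  | m.+1 => cons_measure (lebesgue_tuple m)
  end.

End lebesgue_tuple.

Definition lebesgue_display : measure_display.
Proof. exact: default_measure_display. Qed.

Section lebesgue_rV.
Context {R : realType} (n : nat).

Definition row_of_tuple (t : n.-tuple R) : 'rV[R]_n := \row_i tnth t i.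

(* Outer measure induced by the n-fold product of [lebesgue_measure]. *)
Definition lebesgue_outer (A : set 'rV[R]_n) : \bar R :=
  ((@lebesgue_tuple R n)^*)%mu (row_of_tuple @^-1` A).

Let lebesgue_outer0 : lebesgue_outer set0 = 0%E.
Proof. by rewrite /lebesgue_outer preimage_set0 outer_measure0. Qed.

Let lebesgue_outer_ge0 A : (0 <= lebesgue_outer A)%E.
Proof. exact: outer_measure_ge0. Qed.

Let le_lebesgue_outer : {homo lebesgue_outer : A B / A `<=` B >-> (A <= B)%E}.
Proof. by move=> A B AB; apply: le_outer_measure => t /AB. Qed.

Let lebesgue_outer_sigma_subadditive : sigma_subadditive lebesgue_outer.
Proof.
move=> F; rewrite /lebesgue_outer preimage_bigcup.
exact: outer_measure_sigma_subadditive.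
Qed.

HB.instance Definition _ := isOuterMeasure.Build R 'rV[R]_n lebesgue_outer
  lebesgue_outer0 lebesgue_outer_ge0 le_lebesgue_outer
  lebesgue_outer_sigma_subadditive.

(* R^n with the Lebesgue (i.e. Caratheodory) measurable sets. *)
Definition lebesgue_rV : Type := 'rV[R]_n.

HB.instance Definition _ := Pointed.on lebesgue_rV.

HB.instance Definition _ := @isMeasurable.Build lebesgue_display lebesgue_rV
  lebesgue_outer.-caratheodory
  (caratheodory_measurable_set0 lebesgue_outer)
  (@caratheodory_measurable_setC R _ lebesgue_outer)
  (@caratheodory_measurable_bigcup R _ lebesgue_outer).

Definition lebesgue_measure_rV : set lebesgue_rV -> \bar R := lebesgue_outer.

HB.instance Definition _ := isMeasure.Build _ lebesgue_rV R lebesgue_measure_rV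
  (@caratheodory_measure0 R _ lebesgue_outer)
  (@caratheodory_measure_ge0 R _ lebesgue_outer)
  (@caratheodory_measure_sigma_additive R _ lebesgue_outer).

End lebesgue_rV.

Arguments lebesgue_rV : clear implicits.
Arguments lebesgue_measure_rV : clear implicits.

Section variable_exponent.
Context {R : realType} {n : nat} (Omega : set 'rV[R]_n).
Local Notation T := (lebesgue_rV R n).
Local Notation mu := (lebesgue_measure_rV R n).

(* Measurable functions on [Omega] are represented by measurable functions on
   the whole space, of which only the values on [Omega] matter. *)
Definition mfun_lmod : lmodType R := {mfun T >-> R}.

Definition ae_null : {pred mfun_lmod} :=
  [pred f : {mfun T >-> R} | `[< {ae mu, forall x, Omega x -> f x = 0} >]].

Let ae_null_submod : submod_closed ae_null.
Proof.
split; first by apply/asboolP; exact: aeW.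
move=> a f g /asboolP f0 /asboolP g0; apply/asboolP.
apply: (@filterS2 _ _ (ae_filter_ringOfSetsType mu) _ _ _ _ f0 g0).
move=> x fx gx Ox.
have fx0 := fx Ox; have gx0 := gx Ox.
transitivity (a * (f : {mfun T >-> R}) x + (g : {mfun T >-> R}) x) => //.
by rewrite fx0 gx0 mulr0 addr0.
Qed.

HB.instance Definition _ := GRing.isOppClosed.Build mfun_lmod ae_null
  (GRing.zmod_closedN (GRing.submod_closedB ae_null_submod)).
HB.instance Definition _ := GRing.isSubmodClosed.Build R mfun_lmod ae_null
  ae_null_submod.

Definition L0 : Type := Quotient.quot ae_null.

HB.instance Definition _ := GRing.Zmodule.on L0.
HB.instance Definition _ := EqQuotient.on L0.

Local Open Scope quotient_scope.

Definition L0_scale (a : R) (u : L0) : L0 := \pi_L0 (a *: repr u).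

Lemma L0_piZ a (f : mfun_lmod) : L0_scale a (\pi_L0 f) = \pi_L0 (a *: f).
Proof.
apply/eqP; rewrite /L0_scale -Quotient.idealrBE -scalerBr.
by rewrite rpredZ// Quotient.idealrBE reprK.
Qed.

Lemma L0_piD (f g : mfun_lmod) : \pi_L0 f + \pi_L0 g = \pi_L0 (f + g).
Proof. by symmetry; exact: (@Quotient.pi_add mfun_lmod ae_null). Qed.

Let L0_scaleA a b u : L0_scale a (L0_scale b u) = L0_scale (a * b) u.
Proof. by rewrite -[u]reprK (L0_piZ b) (L0_piZ (a * b)) L0_piZ scalerA. Qed.

Let L0_scale1 : left_id 1 L0_scale.
Proof. by move=> u; rewrite -[u]reprK L0_piZ scale1r. Qed.

Let L0_scaleDr : right_distributive L0_scale +%R.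
Proof.
move=> a u v; rewrite -[u]reprK -[v]reprK.
by rewrite L0_piD !L0_piZ L0_piD scalerDr.
Qed.

Let L0_scaleDl u : {morph L0_scale^~ u : a b / a + b}.
Proof.
by move=> a b; rewrite -[u]reprK !L0_piZ L0_piD scalerDl.
Qed.

HB.instance Definition _ := GRing.Zmodule_isLmodule.Build R L0
  L0_scaleA L0_scale1 L0_scaleDr L0_scaleDl.

(* Independent of the representative when the integrand is measurable. *)
Definition Lp_modular (p : 'rV[R]_n -> R) (u : L0) : \bar R :=
  (\int[mu]_(x in Omega) (`|(repr u : {mfun T >-> R}) x| `^ p x)%:E)%E.

End variable_exponent.

Arguments L0 : clear implicits.

(* Main.v *)
(* Suppose [rho (x_k) -> 0], [rho (s x_k) -> 0] as [s -> 0], but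
   [rho (t x_k) = oo] for every [t > 1].  The points [t x_k] converge to [x_k]
   as [t -> 1], and [x_k] to [0], so [0] is in the closure of
   [{t x_k | k, t > 1}].  Under first countability a sequence
   [y_i = t_i x_(k_i)] with [k_i >= i] would converge to [0]; but [{y_i}] is
   closed as soon as no [z] is a modular limit of such a sequence.

   For a modular [\int_D |f|^p] with [p] unbounded, take sets [A_j] in
   [{p > j^2}] of finite positive measure, and let [|x_k|^p] be
   [\sum_(j >= k) 2^-(j+1) 1_(A_j) / mu A_j].  Then [\int_D |t x_k|^p] is at
   least [t^(j^2) 2^-(j+1)] for every [j >= k], and [x_k] vanishes on
   [{p <= k}], so that [t x_k] stays away from any [z <> 0].  Sequence spaces
   are the case of the counting measure. *)
Require Import Defs.
From HB Require Import structures.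
From mathcomp Require Import all_boot all_order all_algebra.
From mathcomp Require Import generic_quotient ring_quotient.
From mathcomp Require Import all_classical all_reals all_analysis.
From mathcomp Require Import measurable_realfun ring lra.
Import Order.TTheory GRing.Theory Num.Theory.
Import numFieldNormedType.Exports.
Local Open Scope classical_set_scope.
Local Open Scope ring_scope.
Local Open Scope quotient_scope.

(** * A criterion for the failure of first countability *)

Lemma not_first_countable_modular (R : realType) (V : lmodType R)
    (rho : V -> \bar R) (x : nat -> V) :
  rho 0 = 0%E ->
  (forall v, v != 0 -> (0 < rho v)%E) ->
  (forall k, (rho (x k) < +oo)%E) ->
  (forall e : R, 0 < e -> exists N, forall k, (N <= k)%N ->
      (rho (x k) < e%:E)%E) ->
  (forall k (e : R), 0 < e -> exists2 s : R, 0 < s &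
      (rho (s *: x k) < e%:E)%E) ->
  (forall k (t : R), 1 < t -> rho (t *: x k) = +oo%E) ->
  (forall z, z != 0 -> exists c : R, exists N, 0 < c /\
     forall k t, (N <= k)%N -> 1 < t -> (c%:E <= rho (t *: x k - z)%R)%E) ->
  ~ first_countable (modular_space rho).
Proof.
move=> rho0 rho_gt0 x_fin x_cvg x_scale x_oo x_sep.
have in_car v t : 0 < t -> (rho v < +oo)%E -> t *: v \in modular_carrier rho.
  move=> t0 v_fin; apply/mem_set; exists t^-1; first by rewrite invr_gt0.
  by rewrite scalerA mulVf ?scale1r// gt_eqF.
have car0 : 0 \in modular_carrier rho.
  by apply/mem_set; exists 1; rewrite ?ltr01// scaler0 rho0 ltry.
pose o : modular_space rho := SigSub car0.
move=> /(_ o)[B [cB Bo Bbase]].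
(* Enumerates [B]. If [B] is empty, [f] is constantly [set0], which is no neighbourhood of [o];
   hence the guard [nbhs o (f i)] in [pick]. *)
have [f Bf] : exists f : nat -> set (modular_space rho), B `<=` range f.
  have [->|/set0P[W BW]] := eqVneq B set0; first by exists (fun=> set0).
  move/pcard_injP : cB => -[g].
  pose f n := if pselect (exists2 U, B U & g U = n)
    is left e then projT1 (cid2 e) else W.
  move=> ginj; exists f => U BU; exists (g U) => //; rewrite /f.
  case: pselect => [e|[]]; last by exists U.
  by case: cid2 => U' BU' /= gU'; apply: ginj; rewrite ?inE.
have pick i : exists kty : nat * R * modular_space rho,
    [/\ (i <= kty.1.1)%N, 1 < kty.1.2, val kty.2 = kty.1.2 *: x kty.1.1 &
        nbhs o (f i) -> f i kty.2].
  have [fi|nfi] := pselect (nbhs o (f i)); last first.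
    have t0 : (0 : R) < 2 by [].
    exists (i, 2, SigSub (in_car _ _ t0 (x_fin i))); split => //=.
    by rewrite ltr1n.
  have [U [oU Uo Ufi]] : exists U, [/\ modular_open U, U o & U `<=` f i].
    move: fi; rewrite nbhsE => -[U [oU Uo] Ufi]; exists U; split=> //.
  (* Modular balls need not be open, so openness of [U] is used twice: at 0 to bring [x k] into [U],
     then at [x k] to bring (1 + s) x_k into [U]. *)
  have [e e0 eU] := oU _ Uo.
  have [N xN] := x_cvg _ e0.
  pose k := maxn i N.
  have xk_car : x k \in modular_carrier rho.
    by rewrite -[x k]scale1r; exact: in_car.
  have Uxk : U (SigSub xk_car).
    by apply: eU; rewrite /modular_ball/= subr0; apply: xN; exact: leq_maxr.
  have [e' e'0 e'U] := oU _ Uxk.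
  have [s s0 xs] := x_scale k _ e'0.
  have s1 : 0 < 1 + s by rewrite addr_gt0.
  exists (k, 1 + s, SigSub (in_car _ _ s1 (x_fin k))); split => //=.
  - exact: leq_maxl.
  - by rewrite ltrDl.
  - move=> _; apply: Ufi; apply: e'U.
    by rewrite /modular_ball/= scalerDl scale1r addrAC subrr add0r.
have [kty /all_and4[ki ti yE fy]] := choice pick.
pose y i := (kty i).2.
have y_oo i : rho (val (y i)) = +oo%E by rewrite /y yE x_oo.
(* Around 0 radius 1 works, since [rho] is infinite at every y_i. Around z <> 0, [x_sep] handles i
   >= N because k_i >= i; the finitely many other y_i differ from z, so [rho_gt0] leaves a positive
   minimum. *)
have oC : modular_open (~` range y).
  move=> z zy; have [z0|z0] := eqVneq (val z) 0.
    exists 1 => // w; rewrite /modular_ball/= z0 subr0 => w1 [i _ iw].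
    by move: w1; rewrite -iw y_oo.
  have [c [N [c0 cN]]] := x_sep _ z0.
  have [e [e0 eN]] : exists e : R, 0 < e /\
      forall i, (i < N)%N -> (e%:E <= rho (val (y i) - val z)%R)%E.
    elim: (N) => [|M [e [e0 eM]]]; first by exists 1.
    have : (0 < rho (val (y M) - val z)%R)%E.
      apply: rho_gt0; rewrite subr_eq0; apply/eqP => /val_inj yz.
      by apply: zy; exists M.
    case rM : (rho _) => [r| |]// r0.
    - exists (Num.min e r); split; first by rewrite lt_min e0.
      move=> i; rewrite ltnS leq_eqVlt => /predU1P[->|/eM].
        by rewrite rM lee_fin ge_min lexx orbT.
      by apply: le_trans; rewrite lee_fin ge_min lexx.
    - exists e; split => // i; rewrite ltnS leq_eqVlt => /predU1P[->|/eM//].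
      by rewrite rM leey.
  exists (Num.min c e); first by rewrite lt_min c0.
  move=> w; rewrite /modular_ball/= => we [i _ iw]; move: we.
  apply/negP; rewrite -leNgt -iw.
  have [iN|Ni] := ltnP i N.
    by apply: le_trans (eN _ iN); rewrite lee_fin ge_min lexx orbT.
  rewrite /y yE; apply: le_trans (cN _ _ (leq_trans Ni (ki i)) (ti i)).
  by rewrite lee_fin ge_min lexx.
have Co : nbhs o (~` range y).
  rewrite nbhsE; exists (~` range y) => //; split=> //.
  by move=> [i _ yo]; have := y_oo i; rewrite yo /= rho0.
(* Some basic neighbourhood f_i avoids the whole sequence, yet it contains y_i. *)
have [W BW WC] := Bbase _ Co.
have [i _ fiW] := Bf _ BW.
apply: (WC (y i)); last by exists i.
by rewrite -fiW; apply: fy; rewrite fiW; exact: Bo.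
Qed.

(** * Modulars with variable exponent on a measure space *)

(** Bernoulli's inequality gives a with l^a >= 4. For m >= a, l^(m^2) = (l^m)^m >= 4^m, so the
    quotient is at least 2^m / 2. The condition k <= m places the m-th set in the tail starting at
    k. *)
Lemma expr_sq_div2_unbounded (R : archiRealFieldType) (l M : R) (k : nat) :
  1 < l -> exists2 m, (k <= m)%N & M <= l ^+ (m ^ 2) / 2 ^+ m.+1.
Proof.
move=> l1.
have bern n : 1 + (l - 1) * n%:R <= l ^+ n.
  elim: n => [|n IH]; first by rewrite mulr0 addr0 expr0.
  rewrite exprS; apply: (@le_trans _ _ (l * (1 + (l - 1) * n%:R))).
    rewrite -subr_ge0 [leRHS](_ : _ = (l - 1) ^+ 2 * n%:R).
      by rewrite mulr_ge0// sqr_ge0.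
    by rewrite -natr1; ring.
  by rewrite ler_wpM2l// ltW// (lt_trans ltr01).
have l10 : 0 < l - 1 by rewrite subr_gt0.
pose a := (Num.trunc (3 / (l - 1))).+1.
have l4 : 4 <= l ^+ a.
  apply: le_trans (bern a); rewrite -lerBlDl mulrC -ler_pdivrMr//.
  apply: (@le_trans _ _ (3 / (l - 1))).
    by rewrite ler_wpM2r ?invr_ge0 ?(ltW l10)//; lra.
  by apply/ltW/truncnS_gt.
pose m := maxn k (maxn a (Num.trunc (2 * M)).+1).
have am : (a <= m)%N by rewrite /m !leq_max leqnn orbT.
exists m; first exact: leq_maxl.
have l4m : 4 ^+ m <= l ^+ (m ^ 2).
  rewrite -mulnn exprM lerXn2r ?nnegrE ?exprn_ge0 ?(ltW (lt_trans ltr01 l1))//.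
  by apply: le_trans l4 _; rewrite ler_weXn2l// ltW.
have Mm : 2 * M <= 2 ^+ m.
  apply: le_trans (ltW (truncnS_gt (2 * M))) _.
  rewrite -natrX ler_nat; apply: leq_trans (ltnW (ltn_expl m (ltnSn 1))).
  by rewrite /m !leq_max leqnn !orbT.
rewrite ler_pdivlMr ?exprn_gt0// exprS mulrCA mulrA.
apply: le_trans l4m; rewrite (_ : 4 = 2 * 2 :> R); last by rewrite -natrM.
by rewrite exprMn ler_wpM2r// exprn_ge0.
Qed.

Section variable_exponent_modular.
Context d (T : measurableType d) (R : realType).
Variables (mu : {measure set T -> \bar R}) (D : set T) (p : T -> R).
Hypotheses (mD : measurable D) (mp : measurable_fun D p).
Hypothesis p_ge1 : forall x, D x -> 1 <= p x.

Definition var_modular (f : T -> R) : \bar R :=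
  (\int[mu]_(x in D) (`|f x| `^ p x)%:E)%E.

(** Off the zeros of [f] the power is exp (q ln f). At the zeros it is 0 because [q] does not
    vanish; [powR] sends 0 to 1 at exponent 0. *)
Lemma measurable_fun_powR (f q : T -> R) : measurable_fun D f ->
  measurable_fun D q -> (forall x, D x -> q x != 0) ->
  measurable_fun D (fun x => f x `^ q x).
Proof.
move=> mf mq q0.
apply: (eq_measurable_fun
  (fun x => if f x == 0 then 0 else expR (q x * ln (f x)))).
  move=> x /set_mem Dx; rewrite /powR; case: ifPn => // _.
  by rewrite (negbTE (q0 _ Dx)).
apply: measurable_fun_if => //.
- by apply: measurable_fun_eqr => //; exact: measurable_cst.
- apply: measurableT_comp; first exact: measurable_expR.
  apply: measurable_funS (@subIsetl _ _ _) _ => //.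
  apply: measurable_funM => //.
  by apply: measurableT_comp => //; exact: measurable_ln.
Qed.

Let p_neq0 x : D x -> p x != 0.
Proof. by move=> /p_ge1; apply: contraTneq => ->; rewrite -ltNge ltr01. Qed.

Lemma measurable_var_modular (f : T -> R) : measurable_fun D f ->
  measurable_fun D (fun x => (`|f x| `^ p x)%:E).
Proof.
move=> mf; apply/measurable_EFinP; apply: measurable_fun_powR => //.
exact: measurableT_comp.
Qed.

Hypothesis p_large : forall m : nat, exists A : set T,
  [/\ measurable A, A `<=` D, (forall x, A x -> m%:R < p x) &
      (0 < mu A < +oo)%E].

(** These are the x_k of the criterion. The bound s / 2^k yields both x_k -> 0, at s = 1, and s x_k
    -> 0 as s -> 0; the last clause serves the separation from z <> 0. *)
Lemma var_modular_tails : exists f : nat -> {mfun T >-> R}, [/\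
  forall k (s : R), 0 < s -> s <= 1 ->
    (var_modular (fun x => (s * f k x)%R) <= (s / 2 ^+ k)%:E)%E,
  forall k (l : R), 1 < l -> var_modular (fun x => (l * f k x)%R) = +oo%E &
  forall k x, D x -> p x <= k%:R -> f k x = 0].
Proof.
have /choice[A Aprop] := fun m : nat => p_large (m ^ 2)%N.
have mA m : measurable (A m) by have [] := Aprop m.
have AD m : A m `<=` D by have [] := Aprop m.
have Ap m x : A m x -> (m ^ 2)%:R < p x by have [_ _ + _] := Aprop m; apply.
have muA m : (fine (mu (A m)))%:E = mu (A m).
  by have [_ _ _ /andP[a0 aoo]] := Aprop m; rewrite fineK// ge0_fin_numE// ltW.
have muA0 m : 0 < fine (mu (A m)).
  by have [_ _ _ /andP[a0 aoo]] := Aprop m; rewrite -lte_fin muA.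
(* Normalised so that w_m 1_(A_m) has integral 2^-(m+1). *)
pose w m := (fine (mu (A m)))^-1 / 2 ^+ m.+1.
have w0 m : 0 <= w m by rewrite divr_ge0 ?invr_ge0 ?exprn_ge0// ltW.
pose g k j x : \bar R := (w (k + j)%N * \1_(A (k + j)%N) x)%:E.
have g0 k j x : (0 <= g k j x)%E by rewrite lee_fin mulr_ge0.
have mg k j : measurable_fun D (g k j).
  apply/measurable_EFinP; apply: measurable_funM => //.
pose G k x : \bar R := (\sum_(0 <= j <oo) g k j x)%E.
have G0 k x : (0 <= G k x)%E by exact: nneseries_ge0.
have A_out m x : p x <= m%:R -> \1_(A m) x = 0 :> R.
  move=> pm; rewrite indicE memNset// => /Ap; apply/negP; rewrite -leNgt.
  apply: le_trans pm _; rewrite ler_nat; case: (m) => // n.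
  by rewrite -mulnn leq_pmulr.
(* Only indices with k + j < p x contribute at x, so the series is pointwise a finite sum. *)
have Goo k x : (G k x < +oo)%E.
  pose N := (Num.trunc (p x)).+1.
  rewrite /G (@nneseries_split _ _ 0%N N)// add0n.
  rewrite eseries0 ?adde0 ?sumEFin ?ltry// => i Ni _.
  rewrite /g A_out ?mulr0//.
  apply: le_trans (ltW (truncnS_gt (p x))) _.
  by rewrite ler_nat (leq_trans Ni)// leq_addl.
have GE k x : (fine (G k x))%:E = G k x by rewrite fineK// ge0_fin_numE.
have mG k : measurable_fun D (G k).
  apply: (ge0_emeasurable_sum (P := xpredT)) => //.
have intg k j : (\int[mu]_(x in D) g k j x = (2 ^- (k + j).+1)%:E)%E.
  rewrite /g; under eq_integral do rewrite EFinM.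
  rewrite ge0_integralZl//; last 2 first.
  - apply/measurable_EFinP; exact: measurable_funTS.
  - by rewrite lee_fin.
  rewrite integral_indic// setIidl// -muA -EFinM /w mulrAC mulVf ?mul1r//.
  by rewrite gt_eqF.
(* The p-th root of G_k, so that |s f_k|^p = s^p G_k on [D]. *)
pose h k : T -> R := (fun x => fine (G k x) `^ (p x)^-1) \_ D.
have mh k : measurable_fun setT (h k).
  apply/(measurable_restrictT _ mD).1; apply: measurable_fun_powR => //.
  - by apply: measurableT_comp (mG k); exact: fine_measurable.
  - apply: (eq_measurable_fun (fun x => p x `^ (-1))).
      by move=> x /set_mem Dx; rewrite powR_inv1// (le_trans ler01)// p_ge1.
    exact: (measurableT_comp (measurable_powR (-1)) mp).
  - by move=> x Dx; rewrite invr_eq0 p_neq0.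
pose f k : {mfun T >-> R} :=
  HB.pack (h k) (isMeasurableFun.Build _ _ _ _ (h k) (mh k)).
have powf k s x : 0 <= s -> D x ->
    (`|s * f k x| `^ p x)%:E = ((s `^ p x)%:E * G k x)%E.
  move=> s0 Dx; rewrite /= /h patchE mem_set// normrM !ger0_norm ?powR_ge0//.
  rewrite powRM ?powR_ge0// -powRrM mulVf ?p_neq0// powRr1 ?EFinM ?GE//.
  by rewrite fine_ge0.
exists f; split.
- move=> k s s0 s1.
  (* Here s^p <= s because s <= 1 <= p, and the integrals 2^-(k+j+1) sum to at most 2^-k. *)
  apply: (@le_trans _ _ (\int[mu]_(x in D) (s%:E * G k x))%E).
    apply: ge0_le_integral => //.
    - apply: (measurable_var_modular (fun x => s * f k x)).
      apply: measurable_funM => //.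
      exact: measurable_funTS.
    - exact: measurable_funeM.
    - move=> x Dx; rewrite powf ?(ltW s0)// lee_wpmul2r// lee_fin.
      by rewrite ge1r_powR ?s0// p_ge1.
  rewrite ge0_integralZl ?lee_fin ?(ltW s0)//.
  rewrite EFinM lee_wpmul2l ?lee_fin ?(ltW s0)//.
  rewrite integral_nneseries//.
  under eq_eseriesr => j _.
    rewrite intg -addnS exprD invfM -[X in _ * X^-1]natrX.
    over.
  by apply: epsilon_trick0; rewrite invr_ge0 exprn_ge0.
- move=> k l l1; apply/eqyP => M M0.
  (* A single term suffices: p > m^2 on A_m, so that term contributes at least l^(m^2) / 2^(m+1). *)
  have [m km Mm] := expr_sq_div2_unbounded R l M k l1.
  have l0 : 0 <= l by rewrite ltW// (lt_trans ltr01).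
  apply: (@le_trans _ _ (l ^+ (m ^ 2) / 2 ^+ m.+1)%:E).
    by rewrite lee_fin.
  rewrite -(subnKC km) EFinM -intg -ge0_integralZl//; last first.
    by rewrite lee_fin exprn_ge0.
  apply: ge0_le_integral => //.
  - by move=> x _; rewrite mule_ge0// lee_fin exprn_ge0.
  - exact: measurable_funeM.
  - apply: (measurable_var_modular (fun x => l * f k x)).
    by apply: measurable_funM => //; exact: measurable_funTS.
  - move=> x Dx; rewrite powf//.
    have [Ax|Ax] := pselect (A (k + (m - k))%N x); last first.
      by rewrite /g indicE memNset// mulr0 mule0 mule_ge0// lee_fin powR_ge0.
    apply: lee_pmul => //; first by rewrite lee_fin exprn_ge0.
      rewrite lee_fin -powR_mulrn//; apply: ler_powR; first exact: ltW.
      exact/ltW/Ap.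
    (* The first m - k + 1 terms of G_k end with the one for A_m. *)
    apply: le_trans (nneseries_lim_ge (m - k).+1 _) => //.
    by rewrite big_nat_recr//= leeDr// sume_ge0.
- move=> k x Dx pk; rewrite /= /h patchE mem_set//.
  rewrite /G eseries0/=; first by rewrite powR0// invr_eq0 p_neq0.
  move=> j _ _; rewrite /g A_out ?mulr0//.
  by apply: le_trans pk _; rewrite ler_nat leq_addr.
Qed.

(** As [h] is not null, |h|^p has positive integral over some part of [D] where p <= N. There u
    vanishes and |u - h| = |h|, so the bound is uniform in u. *)
Lemma var_modular_sep (h : T -> R) : measurable_fun D h ->
  ~ {ae mu, forall x, D x -> h x = 0} ->
  exists c : R, exists N : nat, 0 < c /\
    forall u : T -> R, measurable_fun D u ->
      (forall x, D x -> p x <= N%:R -> u x = 0) ->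
    (c%:E <= var_modular (fun x => (u x - h x)%R))%E.
Proof.
move=> mh nh0; pose E N := D `&` [set x | p x <= N%:R].
have mE N : measurable (E N).
  by apply: measurable_fun_le => //; exact: measurable_cst.
pose J N := (\int[mu]_(x in E N) (`|h x| `^ p x)%:E)%E.
have J0 N : (0 <= J N)%E.
  by apply: integral_ge0 => x _; rewrite lee_fin powR_ge0.
have mI N (u : T -> R) : measurable_fun D u ->
    measurable_fun (E N) (fun x => (`|u x| `^ p x)%:E).
  move=> mu'; apply: (measurable_funS mD (@subIsetl _ _ _)).
  exact: measurable_var_modular.
have [N JN] : exists N, (0 < J N)%E.
  (* Were every [J N] zero, [h] would vanish a.e. on each [E N]; these cover [D] since [p] is
     finite. *)
  apply: contrapT => /forallNP J_le0; apply: nh0.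
  have : mu.-negligible (\bigcup_N (~` [set x | E N x -> h x = 0])).
    apply: negligible_bigcup => N.
    have JN0 : J N = 0%E.
      by apply/eqP; rewrite eq_le J0 andbT leNgt; apply/negP/J_le0.
    have /(ae_eq_integral_abs mu (mE N) (mI N _ mh)) :
        (\int[mu]_(x in E N) `|(`|h x| `^ p x)%:E| = 0)%E.
      rewrite -[RHS]JN0; apply: eq_integral => x _.
      by rewrite gee0_abs// lee_fin powR_ge0.
    apply: negligibleS => x /= + H; apply; move=> EN; have [] := H EN.
    by move=> /powR_eq0_eq0/normr0_eq0.
  apply: negligibleS => x /=/not_implyP[Dx hx].
  exists (Num.trunc (p x)).+1 => // H; apply: hx; apply: H; split => //.
  exact/ltW/truncnS_gt.
have [c c0 cJ] : exists2 c : R, 0 < c & (c%:E <= J N)%E.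
  case: (J N) JN => [r| |]// r0; first by exists r.
  by exists 1; rewrite ?ltr01 ?leey.
exists c, N; split=> [|u mu' u0]; [exact: c0|apply: (le_trans cJ)].
apply: (@le_trans _ _ (\int[mu]_(x in E N) (`|u x - h x| `^ p x)%:E)%E).
  rewrite le_eqVlt; apply/predU1P; left.
  apply: eq_integral => x /set_mem[Dx px].
  by rewrite u0// sub0r normrN.
apply: ge0_subset_integral => //.
- by apply: measurable_var_modular; exact: measurable_funB.
- exact: subIsetl.
Qed.

End variable_exponent_modular.

(** [F] presents [V] as measurable functions modulo null ones: the identity for sequences, the
    quotient map for Lebesgue spaces. *)
Lemma var_modular_not_first_countable d (T : measurableType d) (R : realType)
    (mu : {measure set T -> \bar R}) (D : set T) (p : T -> R) (V : lmodType R)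
    (rho : V -> \bar R) (F : {mfun T >-> R} -> V) :
  measurable D -> measurable_fun D p -> (forall x, D x -> 1 <= p x) ->
  (forall m : nat, exists A : set T, [/\ measurable A, A `<=` D,
     (forall x, A x -> m%:R < p x) & (0 < mu A < +oo)%E]) ->
  {morph F : f g / f - g} -> (forall a, {morph F : f / a *: f}) ->
  (forall v, exists f, v = F f) ->
  (forall f : {mfun T >-> R}, {ae mu, forall x, D x -> f x = 0} -> F f = 0) ->
  (forall f, rho (F f) = var_modular _ T R mu D p f) ->
  ~ first_countable (modular_space rho).
Proof.
move=> mD mp p1 p_large FB FZ Fsurj F0 rhoF.
have [f [f_small f_oo f_supp]] :=
  var_modular_tails _ _ _ _ _ _ mD mp p1 p_large.
have f_small1 k : (rho (F (f k)) <= (2 ^- k)%:E)%E.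
  have := f_small k 1 ltr01 (lexx 1); rewrite mul1r; apply: le_trans.
  rewrite rhoF le_eqVlt; apply/predU1P; left; congr var_modular.
  by apply/funext => x; rewrite mul1r.
have sep (h : {mfun T >-> R}) : F h != 0 -> exists c : R, exists N : nat,
    0 < c /\ forall u : {mfun T >-> R},
    (forall x, D x -> p x <= N%:R -> u x = 0) -> (c%:E <= rho (F u - F h)%R)%E.
  move=> Fh0.
  have [|ae0|c [N [c0 cN]]] := var_modular_sep _ T R mu _ _ mD mp p1 h.
  - exact: measurable_funTS.
  - by move/eqP : Fh0; apply; exact: F0.
  - exists c, N; split=> [|u u0]; first exact: c0.
    by rewrite -FB rhoF; apply: (cN u) => //; exact: measurable_funTS.
have rhoN v : rho (- v) = rho v.
  have [h ->] := Fsurj v; rewrite -scaleN1r -FZ !rhoF.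
  apply: eq_integral => x _; congr (_ `^ _)%:E.
  by rewrite -[RHS]normrN -[in RHS]mulN1r.
(* The zero function in a form that linearity of [F] sends to 0. Taking it for u in [sep] gives
   positivity of [rho]. *)
have FE0 : F (0 *: f 0%N) = 0 by rewrite FZ scale0r.
apply: (not_first_countable_modular R V rho (fun k => F (f k))).
- rewrite -FE0 rhoF; apply: integral0_eq => x Dx.
  rewrite (_ : (0 *: f 0%N) x = 0) ?normr0; last exact: mul0r.
  by rewrite powR0// gt_eqF// (lt_le_trans ltr01)// p1.
- move=> v; have [h ->] := Fsurj v => /sep[c [N [c0 cN]]].
  apply: (@lt_le_trans _ _ c%:E); first by rewrite lte_fin.
  rewrite -rhoN -[- F h]add0r -FE0; apply: cN => x _ _.
  exact: mul0r.
- by move=> k; apply: le_lt_trans (f_small1 k) _; exact: ltry.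
- move=> e e0; exists (Num.trunc e^-1).+1 => k ek.
  apply: le_lt_trans (f_small1 k) _; rewrite lte_fin.
  rewrite invf_plt ?posrE ?exprn_gt0//.
  apply: lt_le_trans (truncnS_gt _) _; rewrite -natrX ler_nat.
  exact: leq_trans ek (ltnW (ltn_expl k (ltnSn 1))).
- move=> k e e0; have e2 : 0 < e / 2 by rewrite divr_gt0.
  (* Capped at 1 as [f_small] demands; halving e makes the final bound strict. *)
  exists (Num.min 1 (e / 2)); first by rewrite lt_min ltr01.
  rewrite -FZ rhoF; apply: le_lt_trans (f_small k _ _ _) _.
  + by rewrite lt_min ltr01.
  + by rewrite ge_min lexx.
  + rewrite lte_fin ltr_pdivrMr ?exprn_gt0//.
    apply: (@lt_le_trans _ _ (e * 1)).
      by rewrite mulr1 gt_min ltr_pdivrMr// ltr_pMr// ltr1n orbT.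
    by rewrite ler_wpM2l ?(ltW e0)// exprn_ege1// ler1n.
- by move=> k t t1; rewrite -FZ rhoF; exact: f_oo.
- move=> z; have [h ->] := Fsurj z => /sep[c [N [c0 cN]]].
  exists c, N; split=> // k t Nk t1; rewrite -FZ; apply: cN => x Dx px.
  have fkx : f k x = 0 by apply: f_supp => //; rewrite (le_trans px)// ler_nat.
  by rewrite -[RHS](mulr0 t) -fkx.
Qed.

(** * Sequence spaces *)

Lemma seq_modular_not_first_countable (R : realType) (p : nat -> R) :
  (forall j, 1 <= p j) -> ~ has_ubound (range p) ->
  ~ first_countable (modular_space (seq_modular p)).
Proof.
move=> p1 p_unb.
have counting1 j : @counting nat R [set j] = 1%:E.
  by rewrite /counting asboolT// fset_set1 finmap.cardfs1.
apply: (var_modular_not_first_countable _ nat R counting setT p _ _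
  (fun f : {mfun nat >-> R} => (f : nat -> R^o))) => //.
(* The required sets are singletons {j} with p_j > m, of counting measure 1. *)
- move=> m; apply: contrapT => /forallNP noA; apply: p_unb; exists m%:R.
  move=> _ [j _ <-]; rewrite leNgt; apply/negP => mj; apply: (noA [set j]).
  split => //; first by move=> _ ->.
  by rewrite /= counting1 lte_fin ltr01 ltry.
- move=> a; have ma : measurable_fun setT (a : nat -> R) by [].
  pose f : {mfun nat >-> R} :=
    HB.pack (a : nat -> R) (isMeasurableFun.Build _ _ _ _ (a : nat -> R) ma).
  by exists f.
(* A point where f is nonzero would be a singleton of measure 1 inside a null set. *)
- move=> f [N [mN N0 Nf]]; apply/funext => j; apply: contrapT => fj.
  have Nj : [set j] `<=` N by move=> _ ->; apply: Nf => /(_ I).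
  have : (1%:E <= 0%:E :> \bar R)%E.
    rewrite -(counting1 j) -[leRHS]N0.
    by apply: (le_measure (@counting nat R)) => //; rewrite inE.
  by rewrite lee_fin ler10.
- move=> f; rewrite /var_modular ge0_integral_count//.
Qed.

(** * Boxes, open sets and Lebesgue measure in R^n *)

Lemma measurable_tuple_box (R : realType) n (a b : 'I_n -> R) :
  measurable ([set t | forall i, a i < tnth t i < b i]
    : set (n.-tuple (measurableTypeR R))).
Proof.
rewrite (_ : [set t | _] = \bigcap_(i in [set: 'I_n])
    ((fun t : n.-tuple (measurableTypeR R) => tnth t i) @^-1` `]a i, b i[)).
  apply: fin_bigcap_measurable => // i _.
  rewrite -[X in measurable X]setTI.
  exact: (measurable_tnth i measurableT (measurable_itv `]a i, b i[)).
apply/seteqP; split=> t /= H i.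
  by move=> _; rewrite /= in_itv/=; exact: H.
by have := H i I; rewrite /= in_itv.
Qed.

(** Splitting off the first coordinate makes the box an interval times a smaller box. In dimension 0
    the Dirac mass gives 1. *)
Lemma lebesgue_tuple_box (R : realType) n (a b : 'I_n -> R) :
  (forall i, a i < b i) ->
  (0 < lebesgue_tuple n [set t | forall i, (a i < tnth t i < b i)%R] < +oo)%E.
Proof.
elim: n a b => [|n IH] a b ab.
  rewrite /= /dirac indicE mem_set ?ltry ?lte_fin ?ltr01//.
  by move=> [].
rewrite /= /cons_measure /pushforward.
pose B : set (n.-tuple (measurableTypeR R)) :=
  [set t | forall i, a (lift ord0 i) < tnth t i < b (lift ord0 i)].
rewrite (_ : _ @^-1` _ = `]a ord0, b ord0[ `*` B); last first.
  apply/seteqP; split=> -[x t] /=.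
    move=> H; split=> [|i]/=; first by have := H ord0; rewrite in_itv.
    by have := H (lift ord0 i); rewrite tnthS.
  rewrite in_itv/= => -[x0 tB] i.
  by case: (unliftP ord0 i) => [j|] ->; rewrite ?tnthS//; exact: tB.
rewrite product_measure1E//; last exact: measurable_tuple_box.
have lab : lebesgue_measure (`]a ord0, b ord0[ : set R) = (b ord0 - a ord0)%:E.
  by rewrite lebesgue_measure_itv/= lte_fin ab.
rewrite [X in (X * _)%E]lab.
have /andP[B0 Boo] := IH (a \o lift ord0) (b \o lift ord0) (fun i => ab _).
apply/andP; split.
  by rewrite mule_gt0// lte_fin subr_gt0.
by rewrite lte_mul_pinfty// lee_fin subr_ge0 ltW.
Qed.

(** Measurable sets of tuples satisfy the Caratheodory condition for the outer extension of
    [lebesgue_tuple]; it is applied to the preimages of the test sets. *)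
Lemma measurable_rV (R : realType) n (A : set 'rV[R]_n) :
  measurable (@row_of_tuple R n @^-1` A : set (n.-tuple (measurableTypeR R))) ->
  measurable (A : set (lebesgue_rV R n)).
Proof.
move=> mA; suff : (@lebesgue_outer R n).-caratheodory A by [].
move=> X.
exact: (caratheodory_measurable_mu_ext (lebesgue_tuple n) mA
  (@row_of_tuple R n @^-1` X)).
Qed.

Lemma lebesgue_measure_rVE (R : realType) n (A : set 'rV[R]_n) :
  measurable (@row_of_tuple R n @^-1` A : set (n.-tuple (measurableTypeR R))) ->
  lebesgue_measure_rV R n A = lebesgue_tuple n (@row_of_tuple R n @^-1` A).
Proof. exact: measurable_mu_extE. Qed.

Lemma row_of_tuple_box (R : realType) n (a b : 'I_n -> R) :
  @row_of_tuple R n @^-1` [set v : 'rV[R]_n | forall i, a i < v ord0 i < b i] =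
  [set t | forall i, a i < tnth t i < b i].
Proof. by apply/seteqP; split=> t /= H i; have := H i; rewrite mxE. Qed.

(** Balls of the sup norm are cubes. The corners stay free to allow rational ones as well as those
    of a concentric cube. *)
Lemma open_rV_box (R : realType) n (U : set 'rV[R]_n) x : open U -> U x ->
  exists2 e : R, 0 < e &
  forall a b : 'I_n -> R, (forall i, x ord0 i - e < a i) ->
    (forall i, b i < x ord0 i + e) ->
    [set v : 'rV[R]_n | forall i, a i < v ord0 i < b i] `<=` U.
Proof.
rewrite openE => /[apply] /nbhs_ballP[e /= e0 eU]; exists e => //.
move=> a b ax xb v vab.
apply: eU; split => // i j; rewrite [i]ord1 /ball/= ltr_distlC.
have /andP[av vb] := vab j.
by rewrite (lt_trans (ax j))//= (lt_trans vb).
Qed.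

Lemma open_measurable_rV (R : realType) n (U : set 'rV[R]_n) :
  open U -> measurable (U : set (lebesgue_rV R n)).
Proof.
move=> oU; apply: measurable_rV.
(* There are countably many boxes with rational corners, and those inside [U] cover it. *)
pose box (q : {ffun 'I_n -> rat * rat}) : set 'rV[R]_n :=
  [set v : 'rV[R]_n | forall i, ratr (q i).1 < v ord0 i < ratr (q i).2].
rewrite (_ : U = \bigcup_q [set v | box q v /\ box q `<=` U]).
  rewrite preimage_bigcup; apply: countable_bigcupT_measurable => // q.
  have [qU|qU] := pselect (box q `<=` U).
    rewrite (_ : [set v | _] = box q); last by apply/seteqP; split=> v // [].
    by rewrite row_of_tuple_box; exact: measurable_tuple_box.
  rewrite (_ : [set v | _] = set0) ?preimage_set0//.
  by apply/seteqP; split=> v // [].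
apply/seteqP; split=> [x Ux|x [q _ [qx]]]; last exact.
have [e e0 eU] := open_rV_box _ _ _ _ oU Ux.
have rat_near i : exists q : rat * rat,
    x ord0 i - e < ratr q.1 < x ord0 i /\ x ord0 i < ratr q.2 < x ord0 i + e.
  have [|q1] := @rat_in_itvoo R (x ord0 i - e) (x ord0 i).
    by rewrite ltrBlDr ltrDl.
  have [|q2] := @rat_in_itvoo R (x ord0 i) (x ord0 i + e).
    by rewrite ltrDl.
  by rewrite !in_itv/= => h2 h1; exists (q1, q2).
have [q qx] := choice rat_near.
exists (finfun q) => //; split.
  by move=> i; rewrite ffunE; have [/andP[_ ->] /andP[->]] := qx i.
by apply: eU => i; rewrite ffunE; have [/andP[+ _] /andP[_ +]] := qx i.
Qed.

Lemma open_rV_finite_measure (R : realType) n (U : set 'rV[R]_n) :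
  open U -> U !=set0 -> exists A : set (lebesgue_rV R n),
  [/\ measurable A, A `<=` U & (0 < lebesgue_measure_rV R n A < +oo)%E].
Proof.
move=> oU [x Ux]; have [e e0 eU] := open_rV_box _ _ _ _ oU Ux.
pose a i := x ord0 i - e / 2; pose b i := x ord0 i + e / 2.
have e2 : e / 2 < e by rewrite ltr_pdivrMr// ltr_pMr// ltr1n.
have e20 : 0 < e / 2 by rewrite divr_gt0.
have mbox : measurable (@row_of_tuple R n @^-1`
    [set v : 'rV[R]_n | forall i, a i < v ord0 i < b i]
    : set (n.-tuple (measurableTypeR R))).
  by rewrite row_of_tuple_box; exact: measurable_tuple_box.
exists [set v : 'rV[R]_n | forall i, a i < v ord0 i < b i]; split.
- exact: measurable_rV.
- by apply: eU => i; rewrite /a /b ?ltrD2l// ltrN2.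
- rewrite lebesgue_measure_rVE// row_of_tuple_box.
  apply: lebesgue_tuple_box => i.
  by rewrite /a /b ltrD2l (lt_trans _ e20)// oppr_lt0.
Qed.

Lemma measurable_continuous_rV (R : realType) n (U : set 'rV[R]_n)
    (p : 'rV[R]_n -> R) :
  open U -> {within U, continuous p} ->
  measurable_fun (U : set (lebesgue_rV R n)) p.
Proof.
move=> oU cp; have mU := open_measurable_rV _ _ _ oU.
apply: (measurability _ (RGenOpens.measurableE R)).
move=> _ [_ [a [b ->]] <-].
apply: open_measurable_rV; rewrite open_setSI//.
by move/continuousP : cp; apply; exact: itv_open.
Qed.

(** * Lebesgue spaces with variable exponent *)

(** The chosen representative differs from [f] by an element of [ae_null], so both integrands agree
    a.e. on [Omega]. *)
Lemma Lp_modular_piE (R : realType) n (Omega : set 'rV[R]_n) (p : 'rV[R]_n -> R)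
    (f : {mfun lebesgue_rV R n >-> R}) :
  measurable (Omega : set (lebesgue_rV R n)) ->
  measurable_fun (Omega : set (lebesgue_rV R n)) p ->
  (forall x, Omega x -> 1 <= p x) ->
  Lp_modular p (\pi_(L0 R n Omega) (f : mfun_lmod)) =
  var_modular _ _ R (lebesgue_measure_rV R n) Omega p f.
Proof.
move=> mO mp p1; set g := repr (\pi_(L0 R n Omega) (f : mfun_lmod)).
have : (f : mfun_lmod) - g \in @ae_null R n Omega.
  by rewrite Quotient.idealrBE reprK.
move=> /asboolP fg.
rewrite /Lp_modular/var_modular -/g.
apply: ge0_ae_eq_integral => //.
- apply: measurable_var_modular => //; exact: measurable_funTS.
- apply: measurable_var_modular => //; exact: measurable_funTS.
- move: fg; apply: (@filterS _ _
    (ae_filter_ringOfSetsType (lebesgue_measure_rV R n))) => x /= fgx Ox.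
  have /eqP := fgx Ox; rewrite subr_eq0 => /eqP <-.
  by [].
Qed.

Lemma Lp_modular_not_first_countable (R : realType) n (Omega : set 'rV[R]_n)
    (p : 'rV[R]_n -> R) :
  open Omega -> {within Omega, continuous p} ->
  (forall x, Omega x -> 1 <= p x) ->
  ereal_sup [set (p x)%:E | x in Omega] = +oo%E ->
  ~ first_countable (modular_space (@Lp_modular R n Omega p)).
Proof.
move=> oO cp p1 p_sup.
have mO := open_measurable_rV _ _ _ oO.
have mp := measurable_continuous_rV _ _ _ _ oO cp.
have piZ a (f : {mfun lebesgue_rV R n >-> R}) :
    \pi_(L0 R n Omega) (a *: f : mfun_lmod) =
    a *: \pi_(L0 R n Omega) (f : mfun_lmod).
  by rewrite -L0_piZ.
apply: (var_modular_not_first_countable _ _ R (lebesgue_measure_rV R n) Omega p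
  _ _ (fun f => \pi_(L0 R n Omega) (f : mfun_lmod))) => //.
- move=> m.
  (* This set is open by continuity and nonempty as sup p is infinite, so it contains a box of
     finite positive measure. *)
  have oW : open (Omega `&` [set x | m%:R < p x]).
    rewrite open_setSI//.
    by move/continuousP : cp => /(_ _ (@open_gt R m%:R)).
  have W0 : Omega `&` [set x | m%:R < p x] !=set0.
    have /ereal_sup_gt[_ [x Ox <-]] :
        ((m%:R)%:E < ereal_sup [set (p x)%:E | x in Omega])%E.
      by rewrite p_sup ltry.
    by rewrite lte_fin => px; exists x.
  have [A [mA AW A0]] := open_rV_finite_measure _ _ _ oW W0.
  exists A; split=> // x /AW[]//.
- move=> f g; rewrite -[- g]scaleN1r -L0_piD piZ scaleN1r//.
- by move=> v; exists (repr v); rewrite reprK.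
- move=> f f0.
  (* Writing 0 as the class of 0 f turns the goal into an equality of two classes. *)
  rewrite -[RHS](scale0r (\pi_(L0 R n Omega) (f : mfun_lmod))) -piZ.
  apply/eqP; rewrite -Quotient.idealrBE scale0r subr0; exact/asboolP.
- move=> f; exact: Lp_modular_piE.
Qed.

Theorem theorem6p9 (R : realType) :
  (forall p : nat -> R,
     (forall j, 1 <= p j) -> ~ has_ubound (range p) ->
     ~ first_countable (modular_space (seq_modular p))) /\
  (forall (n : nat) (Omega : set 'rV[R]_n) (p : 'rV[R]_n -> R),
     is_domain Omega ->
     {within Omega, continuous p} ->
     (forall x, Omega x -> 1 <= p x) ->
     ereal_sup [set (p x)%:E | x in Omega] = +oo%E ->
     ~ first_countable (modular_space (@Lp_modular R n Omega p))).
Proof.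
split=> [p|n Omega p [_ oO _]]; first exact: seq_modular_not_first_countable.
exact: Lp_modular_not_first_countable.
Qed.
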